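(* Let $n\ge 1$ be an odd integer and let $(W_n,S_E)$ be an edge-signed map on the $n$-wheel $W_n$ such that $S_E(v)=S_E(-v)$ for each pair $v,-v$ of antipodal vertices of $med(W_n)$. Then $L(W_n,S_E)$ is amphichiral.
   Context: Maps. A map $G=(V,E,F)$ is (the image of) an embedding in $\mathbb{S}^2$ of a connected finite planar graph (loops and multiple edges allowed). $G^*$ is its geometric dual. An edge-signed map $(G,S_E)$ is a map with a function $S_E:E\to\{+,-\}$. The $n$-wheel $W_n$ is the plane graph consisting of an $n$-cycle (a loop if $n=1$, two parallel edges if $n=2$) and a center joined to each vertex of the cycle. Medial map. $med(G)$ is the 4-regular map with one vertex on each edge of $G$, two vertices being joined when the corresponding edges are consecutive on a face of $G$. Faces of $med(G)$ containing a vertex of $G$ are colored black, those containing a vertex of $G^*$ white. For a vertex $v$ of $med(G)$ lying on an edge $e$ of $G$ we write $S_E(v)=S_E(e)$. Antipodal vertices. Let $\alpha_2:\mathbb{S}^2\to\mathbb{S}^2$, $x\mapsto -x$. It is known that for odd $n$ the map $W_n$ is antipodally self-dual, i.e. it can be drawn in $\mathbb{S}^2$ so that $\alpha_2(W_n)=W_n^*$, and that then $med(W_n)$ is drawn with $\alpha_2(med(W_n))=med(W_n)$. The antipodal pairs of vertices of $med(W_n)$ are the pairs $v$, $-v=\alpha_2(v)$ in this drawing. Links. $D(G,S_E)$ is the link diagram on $\mathbb{S}^2$ with shadow $med(G)$; the crossing on an edge $e$ has sign $S_E(e)$, where for an observer in a black face at a crossing, looking at the crossing (from outside the sphere), a positive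 crossing is one where the strand on the observer's left passes over the one on the right, a negative crossing is the opposite. $L(G,S_E)$ is the link in $\mathbb{R}^3$ represented by $D(G,S_E)$. Two links in $\mathbb{R}^3$ are equivalent if an orientation-preserving homeomorphism of $\mathbb{R}^3$ maps one onto the other. The mirror image $L^*$ of $L$ is its image under reflection in a plane. $L$ is amphichiral if $L$ is equivalent to $L^*$. *)

(* Defs.v *)
(* MathComp-Analysis world. *)
From HB Require Import structures.
From mathcomp Require Import all_boot all_order all_algebra.
From mathcomp Require Import all_classical all_reals all_analysis.
Set Implicit Arguments.
Unset Strict Implicit.
Unset Printing Implicit Defensive.
Import Order.TTheory GRing.Theory Num.Theory.
Import numFieldNormedType.Exports.
Local Open Scope classical_set_scope.
Local Open Scope ring_scope.

Record graph := Graph {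
  vertex : finType;
  edge : finType;
  src : edge -> vertex;
  tgt : edge -> vertex }.

(* [None] is the center, [Some i] the vertices of the n-cycle; [inl i] is the
   spoke at [Some i], [inr i] the cycle edge from [Some i] to its successor. *)
Definition wheel (n : nat) : graph :=
  @Graph (option 'I_n) ('I_n + 'I_n)%type
    (fun e => match e with inl _ => None | inr i => Some i end)
    (fun e => match e with inl i => Some i | inr i => Some (ordS i) end).

Section Space.
Variable R : realType.

Definition dotp (x y : 'rV[R]_3) : R := \sum_i x 0 i * y 0 i.

(* On the outside of the sphere at [p], [0 < det3 p u w] says that [w] points
   to the left of [u]. *)
Definition det3 (p u w : 'rV[R]_3) : R :=
  \det (col_mx p (col_mx u w) : 'M[R]_3).

Definition sphere : set 'rV[R]_3 := [set x | dotp x x = 1].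

Definition homeomorphism (h : 'rV[R]_3 -> 'rV[R]_3) : Prop :=
  continuous h /\
  exists g : 'rV[R]_3 -> 'rV[R]_3, [/\ continuous g, cancel h g & cancel g h].

(* Local degree +1 at the origin: [x |-> h x - h 0], as a map from the unit
   sphere to the punctured space, is in the homotopy class of the inclusion.
   (The degree of a homeomorphism is 1 or -1, the same at every point.) *)
Definition orientation_preserving (h : 'rV[R]_3 -> 'rV[R]_3) : Prop :=
  exists H : R -> 'rV[R]_3 -> 'rV[R]_3,
    [/\ {within `[0, 1] `*` sphere,
           continuous (fun z : R * 'rV[R]_3 => H z.1 z.2)},
        forall x, sphere x -> H 0 x = x,
        forall x, sphere x -> H 1 x = h x - h 0 &
        forall t x, 0 <= t <= 1 -> sphere x -> H t x != 0].

Definition link_equiv (L L' : set 'rV[R]_3) : Prop :=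
  exists h, [/\ homeomorphism h, orientation_preserving h & h @` L = L'].

(* Reflection in the plane of equation [dotp x u = c], [u] a unit vector. *)
Definition reflection (u : 'rV[R]_3) (c : R) (x : 'rV[R]_3) : 'rV[R]_3 :=
  x - (2 * (dotp x u - c)) *: u.

(* The mirror image may be taken in any plane. *)
Definition amphichiral (L : set 'rV[R]_3) : Prop :=
  forall u c, sphere u -> link_equiv L (reflection u c @` L).

(* Arcs are parametrized by the interval from 0 to 1, from the source to the target; their
   values outside it are irrelevant. *)
Record drawing (G : graph) := Drawing {
  pt : vertex G -> 'rV[R]_3;
  arc : edge G -> R -> 'rV[R]_3 }.

Definition edge_set G (D : drawing G) (e : edge G) : set 'rV[R]_3 :=
  arc D e @` `[0, 1].

Definition drawn G (D : drawing G) : set 'rV[R]_3 :=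
  range (pt D) `|` \bigcup_e edge_set D e.

(* [D] is a map: an embedding in the sphere of the graph [G]. Connectedness of
   the graph is expressed on its image. *)
Record is_map G (D : drawing G) : Prop := IsMap {
  map_sphere : drawn D `<=` sphere;
  map_pt_inj : injective (pt D);
  map_continuous : forall e, {within `[0, 1], continuous (arc D e)};
  map_src : forall e, arc D e 0 = pt D (src e);
  map_tgt : forall e, arc D e 1 = pt D (tgt e);
  map_vertex : forall e t v, 0 < t < 1 -> arc D e t <> pt D v;
  map_simple : forall e e' t t', 0 < t < 1 -> 0 <= t' <= 1 ->
    arc D e t = arc D e' t' -> e = e' /\ t = t';
  map_connected : connected (drawn D) }.

Definition face G (D : drawing G) (F : set 'rV[R]_3) : Prop :=
  exists2 x, (sphere `\` drawn D) x &
    F = connected_component (sphere `\` drawn D) x.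

(* Geometric dual: one vertex of each map in each face of the other, and the
   edges [e] and [f e] meet in exactly one point, all other pairs being
   disjoint. *)
Record is_dual G G' (D : drawing G) (D' : drawing G') (f : edge G -> edge G') :
    Prop := IsDual {
  dual_map : is_map D';
  dual_bij : bijective f;
  dual_off : forall v', ~ drawn D (pt D' v');
  dual_off' : forall v, ~ drawn D' (pt D v);
  dual_face : forall F, face D F -> exists! v', F (pt D' v');
  dual_face' : forall F, face D' F -> exists! v, F (pt D v);
  dual_cross : forall e, exists! x, edge_set D e x /\ edge_set D' (f e) x;
  dual_disjoint : forall e e', e <> e' ->
    edge_set D e `&` edge_set D' (f e') = set0 }.

Definition antipode G (D : drawing G) : drawing G :=
  Drawing (fun v => - pt D v) (fun e t => - arc D e t).

(* [u] is a nonzero velocity of [e] at its interior point [p], for one of its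
   two directions of travel. *)
Definition tangent G (D : drawing G) (e : edge G) (p u : 'rV[R]_3) : Prop :=
  u != 0 /\ exists t, [/\ 0 < t < 1, arc D e t = p &
    is_derive t 1 (arc D e) u \/ is_derive t 1 (arc D e) (- u)].

Section Medial.
Variables (G G' : graph) (D : drawing G) (D' : drawing G').
Variable f : edge G -> edge G'.
(* The graph underlying the medial map has the edges of [G] as vertices. *)
Variables (C : finType) (s t : C -> edge G) (K : drawing (Graph s t)).

(* Edge ends of the medial map. *)
Definition arm_base (a : C * bool) : edge G := if a.2 then t a.1 else s a.1.
Definition arm_param (a : C * bool) (x : R) : R := if a.2 then 1 - x else x.
Definition arm (a : C * bool) (x : R) : 'rV[R]_3 :=
  arc K a.1 (arm_param a x).

(* Tangent vectors at the crossing of [e] with its dual edge, the one of the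
   dual edge pointing to the left of [e]. *)
Definition crossing_frame (e : edge G) (u w : 'rV[R]_3) : Prop :=
  [/\ tangent D e (pt K e) u, tangent D' (f e) (pt K e) w &
      0 < det3 (pt K e) u w].

(* Near [p], [arm a] lies in one of the four angles cut out by [u] and [w]:
   writing [arm a x = z p + y u + y' w], [i] says that [y] is negative (behind
   the crossing along [u]) and [j] that [y'] is negative (on the right of
   [u]). *)
Definition in_angle (p u w : 'rV[R]_3) (i j : bool) (a : C * bool) : Prop :=
  \forall x \near 0^'+, 0 < (-1) ^+ i * det3 p (arm a x) w /\
                        0 < (-1) ^+ j * det3 p u (arm a x).

(* The components of the complement of a map and its dual are the corners of
   the map, each between two consecutive edges on a face. A medial edge runs
   in such a corner, and one leaves each crossing of an edge with its dual in
   each of the four angles there. *)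
Record is_medial : Prop := IsMedial {
  medial_map : is_map K;
  medial_pt : forall e,
    edge_set D e (pt K e) /\ edge_set D' (f e) (pt K e);
  medial_corner : forall c x, 0 < x < 1 ->
    ~ (drawn D `|` drawn D') (arc K c x);
  medial_angles : forall e, exists u w,
    [/\ crossing_frame e u w,
        forall a, arm_base a = e -> exists i j, in_angle (pt K e) u w i j a &
        forall i j, exists! a, arm_base a = e /\
                               in_angle (pt K e) u w i j a] }.

(* An observer walking on [e] from either end to the crossing stands in a
   black face. The strand on his left consists of the arms in the angles
   (behind, left) and (ahead, right), as seen in the direction [u]; the other
   strand of those in (ahead, left) and (behind, right). *)
Definition on_left (a : C * bool) : Prop :=
  exists u w i, crossing_frame (arm_base a) u w /\
                in_angle (pt K (arm_base a)) u w i (~~ i) a.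
Definition on_right (a : C * bool) : Prop :=
  exists u w i, crossing_frame (arm_base a) u w /\
                in_angle (pt K (arm_base a)) u w i i a.

(* [L] is obtained by lifting the edges of the medial map radially to varying
   distances [rho] from the origin, so that opposite arms at a crossing are
   joined and the strand that passes over, as seen from outside the sphere, is
   the farther one; it is the left one iff the sign is + (i.e. [true]). *)
Definition represents (S : edge G -> bool) (L : set 'rV[R]_3) : Prop :=
  exists rho : C -> R -> R,
    let height a := rho a.1 (arm_param a 0) in
    [/\ forall c, {within `[0, 1], continuous (rho c)},
        forall c x, 0 <= x <= 1 -> 0 < rho c x,
        L = \bigcup_c ((fun x => rho c x *: arc K c x) @` `[0, 1]),
        forall a b, arm_base a = arm_base b ->
          (on_left a /\ on_left b) \/ (on_right a /\ on_right b) ->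
          height a = height b &
        forall a b, arm_base a = arm_base b -> on_left a -> on_right b ->
          if S (arm_base a) then height b < height a
          else height a < height b].

End Medial.
End Space.

(* Main.v *)
(* A reflection is the antipode x |-> - x followed by an orientation-preserving
   isometry, so it suffices to carry L onto - L by a homeomorphism isotopic to the
   identity. The antipode exchanges the map with its dual, hence maps the crossing
   on e to the crossing on the dual edge of e, left strands to left strands and
   right strands to right strands. As the signs agree, over each point of the
   medial map L and - L have the same strands in the same radial order. On the
   logarithms of the heights, two strands at a crossing are matched by an
   increasing affine map. Its slope, prescribed at the crossings, extends to a
   positive continuous function on the sphere by Tietze; the constant term is then
   determined over the medial map, where it is continuous, and extends too. The
   resulting homeomorphism preserves the rays from the origin. *)
Require Import Defs.
From mathcomp Require Import all_boot all_order all_algebra.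
From mathcomp Require Import ring lra.
From mathcomp Require Import all_classical all_reals all_analysis.
Import Order.TTheory GRing.Theory Num.Theory.
Import numFieldNormedType.Exports.
Set Implicit Arguments.
Unset Strict Implicit.
Unset Printing Implicit Defensive.
Local Open Scope classical_set_scope.
Local Open Scope ring_scope.

(* [arc] alone would denote the sub-arcs of a cyclic sequence of [path.v]. *)
Local Notation arc := Defs.arc.

(** * Continuity and extension *)

Lemma within_continuous_comp (X Y Z : topologicalType) (A : set X) (B : set Y)
    (f : X -> Y) (g : Y -> Z) :
  {within A, continuous f} -> (forall x, A x -> B (f x)) ->
  {within B, continuous g} -> {within A, continuous (g \o f)}.
Proof.
move=> /subspace_continuousP cf AB /subspace_continuousP cg.
apply/subspace_continuousP => x Ax U gU.
have {gU} fU := cf x Ax _ (cg _ (AB _ Ax) U gU).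
rewrite /= /nbhs /= /within /= in fU *.
by apply: filterS fU => y fy Ay; apply: fy => //; exact: AB.
Qed.

Section Square.
Variables (R : realType) (V : topologicalType) (f : R -> V).
Let J := `[0, 1]%classic : set R.
Hypothesis continuous_f : {within J, continuous f}.

Lemma continuous_square1 : {within J `*` J, continuous (fun z : R * R => f z.1)}.
Proof.
apply: (@within_continuous_comp _ R _ _ J (fun z : R * R => z.1) f) => //.
  by apply: continuous_subspaceT => z; exact: cvg_fst.
by move=> z [].
Qed.

Lemma continuous_square2 : {within J `*` J, continuous (fun z : R * R => f z.2)}.
Proof.
apply: (@within_continuous_comp _ R _ _ J (fun z : R * R => z.2) f) => //.
  by apply: continuous_subspaceT => z; exact: cvg_snd.
by move=> z [].
Qed.
End Square.

Lemma near_at_right0P (R : realType) (P : set R) :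
  (\forall x \near 0^'+, P x) -> exists2 e : R, 0 < e & forall x, 0 < x < e -> P x.
Proof.
case=> e /= e0 eP; exists e => // x /andP[x0 xe]; apply: eP => //=.
by rewrite sub0r normrN gtr0_norm.
Qed.

Lemma compact_bigcup_fin (T : topologicalType) (I : finType) (F : I -> set T) :
  (forall i, compact (F i)) -> compact (\bigcup_i F i).
Proof.
move=> cF.
rewrite (_ : \bigcup_i F i = \big[setU/set0]_(i <- enum I) F i).
  by apply: bigsetU_compact => i _; exact: cF.
rewrite -bigcup_seq; apply/seteqP; split=> x [i _ Fx]; exists i => //=.
by rewrite mem_enum.
Qed.

Section Extension.
Variables (R : realType) (V : normedModType R) (I : finType).
Variables (X : topologicalType) (Q : I -> set X).
Variables (p : I -> X -> V) (v : I -> X -> R).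
Hypothesis compactQ : forall i, compact (Q i).
Hypothesis continuous_p : forall i, {within Q i, continuous (p i)}.
Hypothesis continuous_v : forall i, {within Q i, continuous (v i)}.
Hypothesis p_v : forall i j x y, Q i x -> Q j y -> p i x = p j y ->
  v i x = v j y.

(** By [p_v] the functions [v i] descend to one function on the union of the images of the [p i].
    This union is compact, so the function is bounded there and Tietze extends it with the same
    bound. *)
Lemma extension_along : exists B : V -> R, exists M : R,
  [/\ continuous B, forall y, `|B y| <= M &
      forall i x, Q i x -> B (p i x) = v i x].
Proof.
pose D := \bigcup_i (p i @` Q i).
have cD : compact D.
  by apply: compact_bigcup_fin => i; exact: continuous_compact.
have clD : closed D by apply: compact_closed => //; exact: norm_hausdorff.
pose P y r := exists i x, [/\ Q i x, p i x = y & v i x = r].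
(* The default value 0 is taken only off [D]. *)
pose f y := xget 0 (P y).
have fE i x : Q i x -> f (p i x) = v i x.
  move=> Qx; have : P (p i x) (v i x) by exists i, x.
  by move=> /(xgetI 0)[j [y [Qy pE vE]]]; rewrite /f -vE; exact: p_v.
have cf : {within D, continuous f}.
  apply/continuous_closedP => Z clZ; apply/closed_subspaceP.
  (* On [D], the preimage of a closed [Z] is a finite union of images of compact sets, hence
     closed. *)
  exists (\bigcup_i (p i @` (Q i `&` v i @^-1` Z))).
    apply: compact_closed; first exact: norm_hausdorff.
    apply: compact_bigcup_fin => i; apply: continuous_compact.
      by move: (@continuous_p i); apply: continuous_subspaceW => x [].
    have /continuous_closedP/(_ _ clZ)/closed_subspaceP[W clW WE] := @continuous_v i.
    by rewrite setIC -[X in compact X]WE setIC; exact: compact_closedI.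
  apply/seteqP; split => y /=.
    case=> [[i _ [x [Qx Zx] <-]] Dx]; split=> //.
    by rewrite /preimage /= /from_subspace fE.
  case=> Zy [i _ [x Qx xy]]; split; last by exists i => //; exists x.
  exists i => //; exists x => //; split => //.
  by rewrite /= -fE // xy.
have [M [M0 fM]] : exists M, 0 < M /\ forall y, D y -> `|f y| <= M.
  have [M [_ /(_ (`|M| + 1))]] := compact_bounded (continuous_compact cf cD).
  move=> MP; exists (`|M| + 1); split; first by rewrite ltr_wpDl.
  move=> y Dy; apply: MP; last by exists y.
  by rewrite (le_lt_trans (ler_norm M)) // ltrDl.
have [B [fB cB BM]] :=
  continuous_bounded_extension (@pseudometric_normal R V) clD M0 cf fM.
exists B, M; split=> // i x Qx.
by rewrite -fB ?fE // inE; exists i => //; exists x.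
Qed.
End Extension.

(** * Radial homeomorphisms *)

Section Radial.
Variable R : realType.
Local Notation V := 'rV[R]_3.
Implicit Types (x y u : V) (k : R).

Lemma dotpE x y : dotp x y = x 0 0 * y 0 0 + x 0 1 * y 0 1 + x 0 2 * y 0 2.
Proof.
rewrite /dotp !big_ord_recr big_ord0 /= add0r.
by congr (x 0 _ * y 0 _ + x 0 _ * y 0 _ + x 0 _ * y 0 _); apply: val_inj.
Qed.

Lemma dotpZ k x y : dotp (k *: x) y = k * dotp x y.
Proof. by rewrite !dotpE !mxE; ring. Qed.

Lemma dotpC x y : dotp x y = dotp y x.
Proof. by rewrite !dotpE; ring. Qed.

Lemma dotp_ge0 x : 0 <= dotp x x.
Proof. by rewrite dotpE -!expr2 !addr_ge0 ?sqr_ge0. Qed.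

Lemma rV3P x y : x 0 0 = y 0 0 -> x 0 1 = y 0 1 -> x 0 2 = y 0 2 -> x = y.
Proof.
move=> e0 e1 e2; apply/rowP => -[[|[|[|//]]] i].
- by rewrite (_ : Ordinal i = 0) //; exact: val_inj.
- by rewrite (_ : Ordinal i = 1) //; exact: val_inj.
- by rewrite (_ : Ordinal i = 2) //; exact: val_inj.
Qed.

Lemma dotp_eq0 x : (dotp x x == 0) = (x == 0).
Proof.
apply/idP/eqP => [|->]; last by rewrite dotpE !mxE !mul0r !addr0.
rewrite dotpE -!expr2 !paddr_eq0 ?addr_ge0 ?sqr_ge0 // !sqrf_eq0.
by move=> /andP[/andP[/eqP a /eqP b] /eqP c]; apply: rV3P; rewrite mxE.
Qed.

Lemma continuous_dotp (T : topologicalType) (f g : T -> V) :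
  continuous f -> continuous g -> continuous (fun z => dotp (f z) (g z)).
Proof.
move=> cf cg z.
have cc (h : T -> V) i : continuous h -> (fun z => h z 0 i) @ z --> h z 0 i.
  move=> ch; apply: (cvg_comp h (fun M : V => M 0 i) (ch z)).
  exact: coord_continuous.
rewrite /continuous_at dotpE; under eq_fun do rewrite dotpE.
by apply: cvgD; [apply: cvgD|]; apply: cvgM; exact: cc.
Qed.

(** The norm [|x|] of row vectors is the sup norm; rays are parametrized by the Euclidean one, which
    is 1 on [sphere]. *)
Definition enorm x : R := Num.sqrt (dotp x x).
Definition dir x : V := (enorm x)^-1 *: x.

Lemma enorm_eq0 x : (enorm x == 0) = (x == 0).
Proof. by rewrite sqrtr_eq0 -dotp_eq0 eq_le dotp_ge0 andbT. Qed.

Lemma enorm_gt0 x : (0 < enorm x) = (x != 0).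
Proof. by rewrite lt0r enorm_eq0 sqrtr_ge0 andbT. Qed.

Lemma enormZ k x : 0 <= k -> enorm (k *: x) = k * enorm x.
Proof.
move=> k0; rewrite /enorm dotpZ dotpC dotpZ mulrA -expr2 sqrtrM ?sqr_ge0 //.
by rewrite sqrtr_sqr ger0_norm.
Qed.

Lemma sphere_enorm x : sphere x -> enorm x = 1.
Proof. by rewrite /sphere /= /enorm => ->; rewrite sqrtr1. Qed.

Lemma dirZ k x : 0 < k -> dir (k *: x) = dir x.
Proof.
move=> k0; rewrite /dir enormZ ?ltW// scalerA; congr (_ *: _).
by rewrite invfM mulrAC mulVf ?mul1r// gt_eqF.
Qed.

Lemma dir_sphere x : sphere x -> dir x = x.
Proof. by move=> /sphere_enorm xE; rewrite /dir xE invr1 scale1r. Qed.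

Lemma enorm_dir x : x != 0 -> enorm (dir x) = 1.
Proof. by move=> x0; rewrite enormZ ?invr_ge0 ?sqrtr_ge0 // mulVf // enorm_eq0. Qed.

Lemma dirE x : x = enorm x *: dir x.
Proof.
have [->|x0] := eqVneq x 0; first by rewrite /dir !scaler0.
by rewrite /dir scalerA divff ?scale1r // enorm_eq0.
Qed.

Lemma continuous_enorm : continuous enorm.
Proof.
move=> x; apply: (continuous_comp (f := fun x => dotp x x));
  last exact: sqrt_continuous.
by apply: continuous_dotp => z; exact: cvg_id.
Qed.

Lemma continuous_dir x : x != 0 -> {for x, continuous dir}.
Proof.
move=> x0; apply: (@continuousZ _ _ _ (fun y => (enorm y)^-1) id); last exact: cvg_id.
by apply: continuousV; [rewrite enorm_eq0|exact: continuous_enorm].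
Qed.

Lemma ler_coord_enorm x i : `|x 0 i| <= enorm x.
Proof.
rewrite -sqrtr_sqr /enorm ler_sqrt ?dotp_ge0 // /dotp (bigD1 i) //= expr2 lerDl.
by apply: sumr_ge0 => j _; rewrite -expr2 sqr_ge0.
Qed.

Lemma ler_norm_enorm x : `|x| <= enorm x.
Proof.
rewrite [leLHS]mx_normrE; apply/bigmax_leP; split; first exact: sqrtr_ge0.
by move=> -[i j] _ /=; rewrite (ord1 i); exact: ler_coord_enorm.
Qed.

(* On the ray of direction [p], [radial a B] acts on the logarithm of the distance
   to the origin by the affine map of slope [expR (a p)] and constant term [B p]. *)
Definition radial (a B : V -> R) x : V :=
  expR (expR (a (dir x)) * ln (enorm x) + B (dir x)) *: dir x.

Lemma radial0 a B : radial a B 0 = 0.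
Proof. by rewrite /radial /dir !scaler0. Qed.

Lemma radial_ray a B k x : 0 < k -> sphere x ->
  radial a B (k *: x) = expR (expR (a x) * ln k + B x) *: x.
Proof.
move=> k0 sx; rewrite /radial dirZ // dir_sphere // enormZ ?ltW // sphere_enorm //.
by rewrite mulr1.
Qed.

Lemma sphere_dir x : x != 0 -> sphere (dir x).
Proof.
move=> x0; have := enorm_dir x0.
rewrite /sphere /= /enorm => /(congr1 (fun k => k ^+ 2)).
by rewrite sqr_sqrtr ?dotp_ge0 // expr1n.
Qed.

(** On the ray of direction [p], the inverse of the affine map with slope [expR (a p)] and constant
    term [B p] has slope [expR (- a p)] and constant term [- (B p * expR (- a p))], so it is again
    radial. *)
Lemma radialK a B :
  cancel (radial a B) (radial (fun x => - a x) (fun x => - (B x * expR (- a x)))).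
Proof.
move=> x; have [->|x0] := eqVneq x 0; first by rewrite !radial0.
rewrite [radial a B x]/radial radial_ray ?expR_gt0 //; last exact: sphere_dir.
rewrite [RHS]dirE; congr (_ *: _).
rewrite expRK mulrDr mulrA -expRD addNr expR0 mul1r (mulrC (B _)) addrK.
by rewrite lnK // posrE enorm_gt0.
Qed.

(** Away from 0 this is a composition of continuous maps. At 0, where [dir] has no limit, the
    uniform bounds on [a] and [B] force the lengths of the images to 0. *)
Lemma continuous_radial a B M : continuous a -> continuous B ->
  (forall x, `|a x| <= M) -> (forall x, `|B x| <= M) -> continuous (radial a B).
Proof.
move=> ca cB aM BM x; have [->|x0] := eqVneq x 0; last first.
  have cd := continuous_dir x0.
  have cde (f : V -> R) : continuous f -> {for x, continuous (f \o dir)}.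
    by move=> cf; apply: continuous_comp => //; exact: cf.
  pose l y := expR (a (dir y)) * ln (enorm y) + B (dir y).
  apply: (@continuousZ _ _ _ (fun y => expR (l y)) dir) => //.
  apply: (@continuous_comp _ _ _ l); last exact: continuous_expR.
  apply: continuousD; last exact: cde.
  apply: continuousM.
    apply: (cde (expR \o a)) => y.
    by apply: continuous_comp; [exact: ca|exact: continuous_expR].
  apply: continuous_comp; first exact: continuous_enorm.
  by apply: continuous_ln; rewrite enorm_gt0.
rewrite /continuous_at radial0.
apply/(cvgrPdist_lt (FF := nbhs_filter (0 : V))) => e e0.
(* Below 1 the logarithm of the length is nonpositive, so the worst slope is the least one,
   [expR (- M)]; the second bound makes the result less than [ln e] even when the constant term is
   [M]. *)
pose d := Num.min 1 (expR ((ln e - M) / expR (- M))).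
have d0 : 0 < d by rewrite lt_min ltr01 expR_gt0.
have : \forall y \near (0 : V), enorm y < d.
  have := @continuous_enorm 0; rewrite /continuous_at.
  have -> : enorm 0 = 0 by apply/eqP; rewrite enorm_eq0.
  move=> /(cvgrPdist_lt (FF := nbhs_filter (0 : V)))/(_ _ d0); apply: filterS => y.
  by rewrite sub0r normrN ger0_norm // sqrtr_ge0.
apply: filterS => y yd; rewrite sub0r normrN.
have [->|y0] := eqVneq y 0; first by rewrite radial0 normr0.
apply: le_lt_trans (ler_norm_enorm _) _.
rewrite /radial enormZ ?expR_ge0 // enorm_dir // mulr1.
rewrite -[ltRHS]lnK ?posrE // ltr_expR.
move: yd; rewrite lt_min => /andP[y1 yd].
have lny : ln (enorm y) < (ln e - M) / expR (- M).
  by rewrite -ltr_expR lnK // posrE enorm_gt0.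
have lny0 : ln (enorm y) <= 0 by apply: ln_le0; exact: ltW.
have := BM (dir y); rewrite ler_norml => /andP[_ BM'].
have := aM (dir y); rewrite ler_norml => /andP[aM' _].
rewrite ltr_pdivlMr ?expR_gt0 // in lny.
rewrite -ltrBrDr; apply: lt_le_trans (lerB (lexx _) BM').
apply: le_lt_trans lny; rewrite mulrC; apply: ler_wnM2l => //.
by rewrite ler_expR.
Qed.

Lemma radial_can a B :
  cancel (radial (fun x => - a x) (fun x => - (B x * expR (- a x)))) (radial a B).
Proof.
(* Inverting the parameters twice gives back [a] and [B]. *)
have := radialK (fun x => - a x) (fun x => - (B x * expR (- a x))).
rewrite (_ : (fun x => - - a x) = a); last by apply/funext => x; rewrite opprK.
rewrite (_ : (fun x => - (- _ * _)) = B) //; apply/funext => x.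
by rewrite mulNr opprK -mulrA -expRD subrr expR0 mulr1.
Qed.

End Radial.

(** * Mirror images *)

Section ContinuousArithmetic.
Variables (R : realType) (T : topologicalType) (V : normedModType R).
Implicit Types (f g : T -> V) (s t : T -> R).

Lemma continuous_add f g : continuous f -> continuous g ->
  continuous (fun z => f z + g z).
Proof. by move=> cf cg z; apply: cvgD; [exact: cf|exact: cg]. Qed.

Lemma continuous_opp f : continuous f -> continuous (fun z => - f z).
Proof. by move=> cf z; apply: cvgN; exact: cf. Qed.

Lemma continuous_sub f g : continuous f -> continuous g ->
  continuous (fun z => f z - g z).
Proof. by move=> cf cg z; apply: cvgB; [exact: cf|exact: cg]. Qed.

Lemma continuous_scale s f : continuous s -> continuous f ->
  continuous (fun z => s z *: f z).
Proof. by move=> cf cg z; apply: cvgZ; [exact: cf|exact: cg]. Qed.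

Lemma continuous_mul s t : continuous s -> continuous t ->
  continuous (fun z => s z * t z).
Proof. by move=> cf cg z; apply: cvgM; [exact: cf|exact: cg]. Qed.
End ContinuousArithmetic.

Section Mirror.
Variable R : realType.
Local Notation V := 'rV[R]_3.
Implicit Types (x y u : V) (k c t : R).

Definition row3 (a b c : R) : V := \row_j [:: a; b; c]`_j.

(** The cross product, written as a combination of constant vectors with the coordinates of [x] as
    coefficients so that its continuity in [x] is immediate. *)
Definition crossp u x : V :=
  x 0 0 *: row3 0 (u 0 2) (- u 0 1) + x 0 1 *: row3 (- u 0 2) 0 (u 0 0)
  + x 0 2 *: row3 (u 0 1) (- u 0 0) 0.

Lemma crosspE u x : [/\ crossp u x 0 0 = u 0 1 * x 0 2 - u 0 2 * x 0 1,
  crossp u x 0 1 = u 0 2 * x 0 0 - u 0 0 * x 0 2 &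
  crossp u x 0 2 = u 0 0 * x 0 1 - u 0 1 * x 0 0].
Proof.
rewrite /crossp; split; rewrite !mxE -?[\row_j _]/(row3 _ _ _) /=; ring.
Qed.

Lemma dotp_crossp u x :
  dotp (crossp u x) (crossp u x) = dotp u u * dotp x x - dotp u x ^+ 2.
Proof. by have [e0 e1 e2] := crosspE u x; rewrite !dotpE e0 e1 e2; ring. Qed.

Lemma dotp_crosspl u x : dotp (crossp u x) u = 0.
Proof. by have [e0 e1 e2] := crosspE u x; rewrite !dotpE e0 e1 e2; ring. Qed.

Lemma dotp_crosspr u x : dotp (crossp u x) x = 0.
Proof. by have [e0 e1 e2] := crosspE u x; rewrite !dotpE e0 e1 e2; ring. Qed.

Lemma dotpD x y z : dotp (x + y) z = dotp x z + dotp y z.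
Proof. by rewrite !dotpE !mxE; ring. Qed.

Lemma dotpN x y : dotp (- x) y = - dotp x y.
Proof. by rewrite -scaleN1r dotpZ mulN1r. Qed.

(* A path of linear maps from the identity, at [t = 0], to the rotation of angle
   [pi] about the unit vector [u], at [t = 1]; its third term keeps the vectors
   orthogonal to [u] from vanishing at [t = 1 / 2]. *)
Definition half_turn u t x : V :=
  dotp x u *: u + (1 - 2 * t) *: (x - dotp x u *: u) + (t * (1 - t)) *: crossp u x.

(** If the vector vanished, its product with [u] would make [x] orthogonal to [u], its product with
    [x] would then give [t = 1 / 2], and its product with [crossp u x] would read [1 / 4 = 0]. *)
Lemma half_turn_neq0 u t x : sphere u -> sphere x -> half_turn u t x != 0.
Proof.
rewrite /sphere /= => uu xx; apply/negP => /eqP h0.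
have d0 y : dotp (0 : V) y = 0 by rewrite -(scale0r 0) dotpZ mul0r.
have := congr1 (fun y => dotp y u) h0.
rewrite /half_turn d0 !dotpD !dotpZ dotpD dotpN dotpZ dotp_crosspl uu.
rewrite !mulr1 subrr !mulr0 !addr0 => xu0.
have := congr1 (fun y => dotp y x) h0.
rewrite /half_turn d0 xu0 scale0r subr0 add0r dotpD !dotpZ dotp_crosspr xx.
rewrite mulr0 addr0 mulr1 => t2.
have tE : t = 1 / 2 by lra.
have := congr1 (fun y => dotp y (crossp u x)) h0.
rewrite /half_turn d0 xu0 t2 !scale0r !add0r dotpZ dotp_crossp uu xx dotpC xu0 tE.
by move=> ?; lra.
Qed.

(** The antipode followed by a reflection is a half turn about the normal of the plane followed by a
    translation. *)
Lemma reflectionN u c x : reflection u c (- x) = reflection u c 0 + half_turn u 1 x.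
Proof.
rewrite /reflection /half_turn; apply: rV3P; rewrite !mxE !dotpE !mxE;
have [e0 e1 e2] := crosspE u x; ring.
Qed.

Lemma reflectionK u c : sphere u -> involutive (reflection u c).
Proof.
move=> uu x; rewrite /reflection; set k := dotp x u - c.
rewrite dotpD dotpN dotpZ [dotp u u]uu mulr1.
rewrite (_ : dotp x u - 2 * k - c = - k); last by rewrite /k; ring.
by rewrite mulrN scaleNr opprK subrK.
Qed.

Lemma continuous_reflection u c : continuous (reflection u c).
Proof.
have ck k : continuous (fun _ : V => k) by exact: cst_continuous.
have cu : continuous (fun _ : V => u) by exact: cst_continuous.
have ci : continuous (fun x : V => x) by move=> x; exact: cvg_id.
exact: (continuous_sub ci (continuous_scale (continuous_mul (ck 2)
  (continuous_sub (continuous_dotp ci cu) (ck c))) cu)).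
Qed.

Lemma continuous_half_turn u : continuous (fun z : R * V => half_turn u z.1 z.2).
Proof.
have ck k : continuous (fun _ : R * V => k) by exact: cst_continuous.
have cu r : continuous (fun _ : R * V => r : V) by exact: cst_continuous.
have c1 : continuous (fun z : R * V => z.1) by move=> ?; exact: cvg_fst.
have c2 : continuous (fun z : R * V => z.2) by move=> ?; exact: cvg_snd.
have cd := continuous_dotp c2 (cu u).
have cdu := continuous_scale cd (cu u).
have ci i : continuous (fun z : R * V => z.2 0 i).
  by move=> z; exact: (cvg_comp _ _ (c2 z) (@coord_continuous R 1 3 0 i z.2)).
have cc i r := continuous_scale (ci i) (cu r).
have ccross := continuous_add (continuous_add (cc 0 (row3 0 (u 0 2) (- u 0 1)))
  (cc 1 (row3 (- u 0 2) 0 (u 0 0)))) (cc 2 (row3 (u 0 1) (- u 0 0) 0)).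
have c1t := continuous_sub (ck 1) (continuous_mul (ck 2) c1).
have ctt := continuous_mul c1 (continuous_sub (ck 1) c1).
exact: (continuous_add
  (continuous_add cdu (continuous_scale c1t (continuous_sub c2 cdu)))
  (continuous_scale ctt ccross)).
Qed.

Lemma amphichiral_radial a B M (L : set V) :
  continuous a -> continuous B -> (forall x, `|a x| <= M) ->
  (forall x, `|B x| <= M) -> radial a B @` L = -%R @` L -> amphichiral L.
Proof.
move=> ca cB aM BM gL u c su.
pose a' x := - a x; pose B' x := - (B x * expR (- a x)).
have cg : continuous (radial a B) by exact: continuous_radial ca cB aM BM.
have cgN := continuous_opp cg.
have ca' := continuous_opp ca.
have cea : continuous (fun x => expR (- a x)).
  by move=> x; exact: (cvg_comp _ _ (ca' x) (@continuous_expR R (- a x))).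
have cg' : continuous (radial a' B').
  (* [M] bounds the new slope exponent, [M * expR M] the new constant term. *)
  apply: (@continuous_radial _ _ _ (Num.max M (M * expR M))) => //.
  - exact: (continuous_opp (continuous_mul cB cea)).
  - by move=> x; rewrite normrN le_max aM.
  - move=> x; rewrite normrN normrM le_max; apply/orP; right.
    rewrite ler_pM //; rewrite ger0_norm ?expR_ge0 // ler_expR.
    by have := aM x; rewrite ler_norml => /andP[]; rewrite lerNl.
exists (fun x => reflection u c (- radial a B x)); split.
- split.
    by move=> x; exact: (cvg_comp _ _ (cgN x) (@continuous_reflection u c _)).
  exists (fun y => radial a' B' (- reflection u c y)); split.
  + have crN := continuous_opp (@continuous_reflection u c).
    by move=> x; exact: (cvg_comp _ _ (crN x) (cg' _)).
  + by move=> x; rewrite /= reflectionK // opprK; exact: radialK.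
  + by move=> x; rewrite /= radial_can opprK reflectionK.
(* On the unit sphere [ln (enorm x)] is 0, so [radial a B] only scales [x] by [expR (B x)]; the
   homotopy turns and scales at the same time. *)
- exists (fun t x => expR (t * B x) *: half_turn u t x); split.
  + apply: continuous_subspaceT.
    have c1 : continuous (fun z : R * V => z.1) by move=> ?; exact: cvg_fst.
    have c2 : continuous (fun z : R * V => z.2) by move=> ?; exact: cvg_snd.
    have cB2 : continuous (fun z : R * V => B z.2).
      by move=> z; exact: (cvg_comp _ _ (c2 z) (cB z.2)).
    have ctB := continuous_mul c1 cB2.
    have cetB : continuous (fun z : R * V => expR (z.1 * B z.2)).
      by move=> z; exact: (cvg_comp _ _ (ctB z) (@continuous_expR R _)).
    exact: (continuous_scale cetB (@continuous_half_turn u)).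
  + move=> x sx; rewrite mul0r expR0 scale1r /half_turn mulr0 subr0 scale1r.
    by rewrite mul0r scale0r addr0 subrKC.
  + move=> x sx; rewrite radial0 oppr0 reflectionN addrAC subrr add0r.
    rewrite -[in RHS](scale1r x) radial_ray // ln1 mulr0 add0r mul1r.
    set k := expR _; rewrite /half_turn subrr mulr0 !scale0r !addr0.
    by rewrite !dotpZ; apply: rV3P; rewrite !mxE; ring.
  + move=> t x _ sx; rewrite scaler_eq0 negb_or half_turn_neq0 // andbT.
    by rewrite gt_eqF ?expR_gt0.
- have NL : -%R @` (radial a B @` L) = L.
    rewrite gL; apply/seteqP; split => x.
      by move=> [_ [y Ly <-] <-]; rewrite opprK.
    by move=> Lx; exists (- x); rewrite ?opprK //; exists x.
  by rewrite -[in RHS]NL !image_comp.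
Qed.
End Mirror.

(** * Frames at antipodal crossings *)

Section Frames.
Variable R : realType.
Local Notation V := 'rV[R]_3.
Implicit Types (p u w : V).

Lemma det_mx33 (A : 'M[R]_3) : \det A =
  A 0 0 * (A 1 1 * A 2 2 - A 1 2 * A 2 1) - A 0 1 * (A 1 0 * A 2 2 - A 1 2 * A 2 0)
  + A 0 2 * (A 1 0 * A 2 1 - A 1 1 * A 2 0).
Proof.
(* With natural numbers as indices, the ordinals produced by the expansion reduce to literals. *)
pose a (i j : nat) := A (inord i) (inord j).
have aE i j : A i j = a i j by rewrite /a !inord_val.
rewrite (expand_det_row _ 0) !big_ord_recl big_ord0 /cofactor.
rewrite !(expand_det_row _ 0) !big_ord_recl !big_ord0 /cofactor !det_mx11 !mxE.
by rewrite !aE /= /bump /= !addn0 !add0n !addnE /= !exprS expr0; ring.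
Qed.

Lemma det3E p u w : det3 p u w = dotp p (crossp u w).
Proof.
have [e0 e1 e2] := crosspE u w; rewrite dotpE e0 e1 e2 /det3.
set A := (col_mx p (col_mx u w) : 'M[R]_3).
have E0 j : A 0 j = p 0 j.
  by rewrite -(col_mxEu p (col_mx u w)); congr (A _ j); exact: val_inj.
have E1 j : A 1 j = u 0 j.
  rewrite -(col_mxEu u w) -(col_mxEd p (col_mx u w)).
  by congr (A _ j); exact: val_inj.
have E2 j : A 2 j = w 0 j.
  rewrite -(col_mxEd u w) -(col_mxEd p (col_mx u w)).
  by congr (A _ j); exact: val_inj.
rewrite -E0 -!E1 -!E2 det_mx33 -!E0; ring.
Qed.

Lemma det3_poly p u w : det3 p u w =
  p 0 0 * (u 0 1 * w 0 2 - u 0 2 * w 0 1) + p 0 1 * (u 0 2 * w 0 0 - u 0 0 * w 0 2)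
  + p 0 2 * (u 0 0 * w 0 1 - u 0 1 * w 0 0).
Proof. by have [e0 e1 e2] := crosspE u w; rewrite det3E dotpE e0 e1 e2. Qed.

(* Here [(u, w)] is the frame at a crossing [p] and [(u', w')] the frame at [- p]:
   the antipode exchanges the edges of the map and of its dual, hence the two
   vectors of the frame, and exchanging both indices of an angle keeps its parity. *)
Lemma angle_parity p u w u' w' q (i j i' j' : bool) :
  u' = w \/ u' = - w -> w' = u \/ w' = - u ->
  0 < det3 p u w -> 0 < det3 (- p) u' w' ->
  0 < (-1) ^+ i * det3 p q w -> 0 < (-1) ^+ j * det3 p u q ->
  0 < (-1) ^+ i' * det3 (- p) (- q) w' -> 0 < (-1) ^+ j' * det3 (- p) u' (- q) ->
  (i == j) = (i' == j').
Proof.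
set d := det3 p u w; set x := det3 p q w; set y := det3 p u q.
have dwu : det3 (- p) w u = d by rewrite /d !det3_poly !mxE; ring.
have dwu' : det3 (- p) (- w) (- u) = d by rewrite /d !det3_poly !mxE; ring.
have dNwu : det3 (- p) (- w) u = - d by rewrite /d !det3_poly !mxE; ring.
have dwNu : det3 (- p) w (- u) = - d by rewrite /d !det3_poly !mxE; ring.
have yE : det3 (- p) (- q) u = - y by rewrite /y !det3_poly !mxE; ring.
have yNE : det3 (- p) (- q) (- u) = y by rewrite /y !det3_poly !mxE; ring.
have xE : det3 (- p) w (- q) = - x by rewrite /x !det3_poly !mxE; ring.
have xNE : det3 (- p) (- w) (- q) = x by rewrite /x !det3_poly !mxE; ring.
(* Orientation leaves the frames [(w, u)] and [(- w, - u)]. In the second the indices are exchanged;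
   in the first they are exchanged and both negated. *)
case=> ->; case=> ->; rewrite ?(dwu, dwu', dNwu, dwNu, yE, yNE, xE, xNE);
  case: i; case: j; case: i'; case: j' => //=; rewrite ?expr0 ?expr1;
  move=> *; exfalso; lra.
Qed.
End Frames.

(** * Crossings of an antipodally self-dual map *)

Section Antipodal.
Variables (R : realType) (G : graph) (W : drawing R G) (dual : edge G -> edge G).
Hypothesis W_map : is_map W.
Hypothesis W_self_dual : is_dual W (antipode W) dual.
Variables (C : finType) (s t : C -> edge G) (K : drawing R (Graph s t)).
Hypothesis K_medial : is_medial W (antipode W) dual K.

Lemma edge_set_antipode e x : edge_set (antipode W) e x <-> edge_set W e (- x).
Proof.
split=> -[k k01 /= kx]; exists k => //=; first by rewrite -kx opprK.
by rewrite kx opprK.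
Qed.

Lemma pt_edge e : edge_set W e (pt K e) /\ edge_set W (dual e) (- pt K e).
Proof. by have [? /edge_set_antipode] := medial_pt K_medial e. Qed.

(** Let [e = dual e0]. The point [- pt K e] lies on the edge [dual e] of the map and on the edge [e]
    of its antipode, which is dual to [e0]; as other pairs are disjoint, [dual e = e0]. *)
Lemma dualK : involutive dual.
Proof.
move=> e; have [We Wde] := pt_edge e.
have [e0 e0e] : exists e0, dual e0 = e.
  by have [g _ gK] := dual_bij W_self_dual; exists (g e); rewrite gK.
have [->//|/eqP ne] := eqVneq (dual e) e0.
have := dual_disjoint W_self_dual ne; rewrite -subset0 => /(_ (- pt K e)) [].
by split=> //; rewrite e0e; apply/edge_set_antipode; rewrite opprK.
Qed.

(** Both points lie on [dual e] and on its dual edge, which meet only once. *)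
Lemma pt_dual e : pt K (dual e) = - pt K e.
Proof.
have [x [_ xP]] := dual_cross W_self_dual (dual e).
rewrite -(xP (pt K (dual e))) ?(xP (- pt K e)) //.
  have [We Wde] := pt_edge e; split=> //.
  by rewrite dualK; apply/edge_set_antipode; rewrite opprK.
have [We Wde] := pt_edge (dual e); split=> //.
by apply/edge_set_antipode.
Qed.

(** A simple arc passes through [p] at a single parameter, where its derivative is unique. *)
Lemma tangent_unique e p u v : tangent W e p u -> tangent W e p v -> v = u \/ v = - u.
Proof.
move=> [_ [x [x01 xp xu]]] [_ [y [y01 yp yv]]].
have [_ yx] : e = e /\ x = y.
  apply: (map_simple W_map) => //; last by rewrite xp yp.
  by case/andP: y01 => /ltW -> /ltW ->.
have uniq (v1 v2 : 'rV[R]_3) :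
    is_derive x 1 (arc W e) v1 -> is_derive x 1 (arc W e) v2 -> v1 = v2.
  by move=> [_ <-] [_ <-].
rewrite -{}yx in yv.
case: xu yv => [xu|xu] [yv|yv]; have := uniq _ _ xu yv.
- by left.
- by move=> ->; right; rewrite opprK.
- by right.
- by move/oppr_inj; left.
Qed.

Lemma tangent_antipode e p u : tangent (antipode W) e p u -> tangent W e (- p) u.
Proof.
move=> [u0 [x [x01 xp xu]]]; split=> //; exists x; split=> //.
  by rewrite -xp opprK.
have arcE : arc W e = (fun k => - arc (antipode W) e k).
  by apply/funext => k; rewrite /= opprK.
rewrite arcE; case: xu => xu; [right|left].
  exact: is_deriveN.
by rewrite -[u]opprK; exact: is_deriveN.
Qed.

Lemma frame_dual e u w u' w' :
  crossing_frame W (antipode W) dual K e u w ->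
  crossing_frame W (antipode W) dual K (dual e) u' w' ->
  (u' = w \/ u' = - w) /\ (w' = u \/ w' = - u).
Proof.
rewrite /crossing_frame dualK pt_dual.
move=> [Tu /tangent_antipode Tw _] [Tu' /tangent_antipode]; rewrite opprK => Tw' _.
by split; [exact: tangent_unique Tw Tu'|exact: tangent_unique Tu Tw'].
Qed.

End Antipodal.

Lemma natr_bool_inj (R : numDomainType) (b b' : bool) :
  b%:R = b'%:R :> R -> b = b'.
Proof. by move/eqP; rewrite eqr_nat; case: b; case: b'. Qed.

(** * Antipodal strands *)

Lemma natr_bool_close (R : realType) (b b' : bool) (y : R) :
  y = b'%:R -> `|b%:R - y| < 1 -> y = b%:R.
Proof.
by case: b; case: b' => -> //=; rewrite ?subr0 ?sub0r ?normrN normr1 ltxx.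
Qed.

(** An end of a medial edge is the parameter [b%:R], and the arm there is parametrized by the
    distance to it. *)
Lemma arm_param_dist (R : realType) (C : finType) (c : C) (b : bool) (y : R) :
  0 <= y <= 1 -> arm_param (c, b) `|b%:R - y| = y.
Proof.
move=> /andP[y0 y1]; rewrite /arm_param; case: b => /=.
  by rewrite ger0_norm ?subr_ge0 // subKr.
by rewrite sub0r normrN ger0_norm.
Qed.

Section Matching.
Variables (R : realType) (G : graph) (W : drawing R G) (dual : edge G -> edge G).
Hypothesis W_map : is_map W.
Hypothesis W_self_dual : is_dual W (antipode W) dual.
Variables (C : finType) (s t : C -> edge G) (K : drawing R (Graph s t)).
Hypothesis K_medial : is_medial W (antipode W) dual K.
Hypothesis K_antipodal : (fun x : 'rV[R]_3 => - x) @` drawn K = drawn K.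

Local Notation base := (arm_base s t).
Local Notation left := (on_left W (antipode W) dual K).
Local Notation right := (on_right W (antipode W) dual K).

Lemma arc_end c (b : bool) : arc K c b%:R = pt K (base (c, b)).
Proof.
have Km := medial_map K_medial.
by case: b; rewrite /arm_base /= ?(map_src Km) ?(map_tgt Km).
Qed.

Lemma arc_pt c x e : 0 <= x <= 1 -> arc K c x = pt K e -> exists b : bool, x = b%:R.
Proof.
move=> /andP[x0 x1] xe; have Km := medial_map K_medial.
move: x0; rewrite le_eqVlt => /orP[/eqP <-|x0]; first by exists false.
move: x1; rewrite le_eqVlt => /orP[/eqP ->|x1]; first by exists true.
have x01 : 0 < x < 1 by rewrite x0.
by have := map_vertex Km x01 xe.
Qed.

Lemma left_or_right a : left a \/ right a.
Proof.
have [u [w [uw ij _]]] := medial_angles K_medial (base a).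
have [i [j aij]] := ij a erefl.
have [jE|] := eqVneq j i; first by rewrite jE in aij; right; exists u, w, i.
move=> ji; have jE : j = ~~ i by case: i j ji {aij} => -[].
by rewrite jE in aij; left; exists u, w, i.
Qed.

Lemma exists_left e : exists a, base a = e /\ left a.
Proof.
have [u [w [uw _ /(_ false true)[a [[ae aa] _]]]]] := medial_angles K_medial e.
by exists a; split => //; exists u, w, false; rewrite ae.
Qed.

Lemma exists_right e : exists a, base a = e /\ right a.
Proof.
have [u [w [uw _ /(_ false false)[a [[ae aa] _]]]]] := medial_angles K_medial e.
by exists a; split => //; exists u, w, false; rewrite ae.
Qed.

Definition same_side a a' := left a /\ left a' \/ right a /\ right a'.

(** One pair of antipodal points close enough to the crossings to show the angles of both arms
    decides the sides, by [angle_parity]. *)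
Lemma antipodal_side a a' : base a' = dual (base a) ->
  (forall d : R, 0 < d -> exists x x',
     [/\ 0 < x < d, 0 < x' < d & arm K a' x' = - arm K a x]) ->
  same_side a a'.
Proof.
move=> aa' close.
have [u [w [uw /(_ a erefl)[i [j aij]] _]]] := medial_angles K_medial (base a).
have [u' [w' [uw' /(_ a' erefl)[i' [j' aij']] _]]] := medial_angles K_medial (base a').
have [d d0 dP] := near_at_right0P aij.
have [d' d'0 dP'] := near_at_right0P aij'.
have dd0 : 0 < Num.min d d' by rewrite lt_min d0.
have [x [x' [/andP[x0 xd] /andP[x'0 x'd] xx']]] := close _ dd0.
move: xd x'd; rewrite !lt_min => /andP[xd _] /andP[_ xd'].
have [|pi pj] := dP x; first by rewrite x0.
have [|pi' pj'] := dP' x'; first by rewrite x'0.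
have uw'' := uw'; rewrite aa' in uw''.
have [uE wE] := frame_dual W_map W_self_dual K_medial uw uw''.
have [_ _ o] := uw; have [_ _ o'] := uw''.
rewrite (pt_dual W_self_dual K_medial) in o'.
rewrite aa' (pt_dual W_self_dual K_medial) xx' in pi' pj'.
have := angle_parity uE wE o o' pi pj pi' pj'.
have [ij|ij] := eqVneq i j; have [ij'|ij'] := eqVneq i' j' => // _.
  rewrite -ij in aij; rewrite -ij' in aij'.
  by right; split; [exists u, w, i|exists u', w', i'].
have jE : j = ~~ i by case: i j ij {aij pi pj dP} => -[].
have jE' : j' = ~~ i' by case: i' j' ij' {aij' pi' pj' dP'} => -[].
rewrite jE in aij; rewrite jE' in aij'.
by left; split; [exists u, w, i|exists u', w', i'].
Qed.

Lemma same_side_sym a a' : same_side a a' -> same_side a' a.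
Proof. by case=> -[? ?]; [left|right]. Qed.

Lemma antipodal_base a a' : pt K (base a') = - pt K (base a) -> base a' = dual (base a).
Proof.
rewrite -(pt_dual W_self_dual K_medial).
exact: (map_pt_inj (medial_map K_medial)).
Qed.

(* The parameters of antipodal points; at a crossing, where several of them
   give the same point, only those on corresponding strands are related. *)
Definition matched c c' : set (R * R) :=
  [set z | [/\ 0 <= z.1 <= 1, 0 <= z.2 <= 1, arc K c' z.2 = - arc K c z.1 &
    forall b b' : bool, z.1 = b%:R -> z.2 = b'%:R -> same_side (c, b) (c', b')]].

Lemma matched_sym c c' x x' : matched c c' (x, x') -> matched c' c (x', x).
Proof.
case=> /= x01 x'01 xx' ss; split=> //=; first by rewrite xx' opprK.
by move=> b b' xb xb'; apply: same_side_sym; exact: ss.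
Qed.

Lemma matched_end c c' x x' (b : bool) :
  0 <= x' <= 1 -> arc K c' x' = - arc K c x -> x = b%:R ->
  exists b' : bool, x' = b'%:R /\ base (c', b') = dual (base (c, b)).
Proof.
move=> x'01 xx' xb.
have [|b' x'b'] := @arc_pt c' x' (dual (base (c, b))) x'01.
  by rewrite xx' xb arc_end (pt_dual W_self_dual K_medial).
exists b'; split=> //; apply: antipodal_base.
by rewrite -!arc_end -x'b' xx' xb.
Qed.

Lemma matched_total c x : 0 <= x <= 1 -> exists c' x', matched c c' (x, x').
Proof.
move=> x01.
(* At a crossing, an arm on the same side is chosen at the antipodal crossing. Elsewhere the
   antipodal point lies on the medial map, and not at a crossing, since the antipode of a crossing
   is one. *)
have [[b xb]|nb] := pselect (exists b : bool, x = b%:R).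
  have [a' [aE ss]] : exists a', base a' = dual (base (c, b)) /\ same_side (c, b) a'.
    have [l|r] := left_or_right (c, b).
      have [a' [aE l']] := exists_left (dual (base (c, b))).
      by exists a'; split=> //; left.
    have [a' [aE r']] := exists_right (dual (base (c, b))).
    by exists a'; split=> //; right.
  case: a' aE ss => c' b' aE ss; exists c', b'%:R; split=> //=.
  - by case: b' {aE ss}; rewrite ?lexx ler01.
  - by rewrite xb !arc_end aE (pt_dual W_self_dual K_medial).
  - by move=> b1 b1'; rewrite xb => /natr_bool_inj <- /natr_bool_inj <-.
have : drawn K (- arc K c x).
  by rewrite -K_antipodal; exists (arc K c x) => //; right; exists c => //; exists x.
case=> [[e _ ex]|[c' _ [x' x'01 xx']]].
  case: nb; apply: (@arc_pt c x (dual e)) => //.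
  by rewrite (pt_dual W_self_dual K_medial) ex opprK.
exists c', x'; split=> //= b b' xb; case: nb; by exists b.
Qed.

(** Being antipodal is a closed condition. The condition on sides matters only at a limit pair of
    ends: there, nearby matched pairs are either this pair itself or antipodal points on the two
    arms, to which [antipodal_side] applies. *)
Lemma closed_matched c c' : closed (matched c c').
Proof.
have Km := medial_map K_medial.
pose J := `[0, 1]%classic : set R.
pose D := J `*` J : set (R * R).
pose f (z : R * R) := arc K c' z.2 + arc K c z.1.
have c1 := continuous_square1 (@map_continuous _ _ _ Km c).
have c2 := continuous_square2 (@map_continuous _ _ _ Km c').
have cf := continuous_add c2 c1.
have clG : closed (D `&` f @^-1` [set 0]).
  have cl0 : closed [set (0 : 'rV[R]_3)].
    by apply: compact_closed; [exact: norm_hausdorff|exact: compact_set1].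
  have clD : closed D.
    apply: compact_closed; first exact: norm_hausdorff.
    by apply: compact_setX; exact: segment_compact.
  have /continuous_closedP/(_ _ cl0)/closed_subspaceP[Z clZ ZE] := cf.
  by rewrite setIC -[X in closed X]ZE; exact: closedI.
have mG : matched c c' `<=` D `&` f @^-1` [set 0].
  by move=> z [z1 z2 zz _]; split; [split|rewrite /f /= zz addNr].
move=> z zcl; have [[z1 z2] zz] : (D `&` f @^-1` [set 0]) z.
  by apply: clG; exact: closureS zcl.
have {}zz : arc K c' z.2 = - arc K c z.1 by apply/eqP; rewrite -addr_eq0; exact/eqP.
split=> // b b' zb zb'; apply: contrapT => nss.
have near_z d : 0 < d ->
    exists y, [/\ matched c c' y, `|z.1 - y.1| < d & `|z.2 - y.2| < d].
  move=> d0; have [y [my [yz1 yz2]]] := zcl _ (nbhsx_ballx z d d0).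
  by exists y.
apply: (nss); apply: antipodal_side.
  by apply: antipodal_base; rewrite -!arc_end -zb -zb'.
move=> d d0.
(* Distance less than 1 excludes the opposite ends of the two arcs. *)
have [|[y y'] [my]] := near_z (Num.min d 1); first by rewrite lt_min d0 ltr01.
rewrite {}zb {}zb' !lt_min /= => /andP[yd y1] /andP[y'd y'1].
have [/= y01 y'01 yy' ss] := my.
(* If one parameter were at its end, so would be the other, and the nearby pair would be the limit
   pair, whose sides were assumed to differ. *)
have yb : y != b%:R.
  apply/eqP => yb; have [b2 [y'b2 _]] := matched_end y'01 yy' yb.
  by apply: nss; apply: ss => //; apply: natr_bool_close y'b2 y'1.
have y'b : y' != b'%:R.
  apply/eqP => y'b; have yy : arc K c y = - arc K c' y' by rewrite yy' opprK.
  have [b2 [yb2 _]] := matched_end y01 yy y'b.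
  by apply: nss; apply: ss => //; apply: natr_bool_close yb2 y1.
exists `|b%:R - y|, `|b'%:R - y'|; rewrite yd y'd !normr_gt0 !subr_eq0.
by rewrite !(eq_sym _%:R) yb y'b /arm !arm_param_dist.
Qed.

Lemma matched_square c c' : matched c c' `<=` `[0, 1]%classic `*` `[0, 1]%classic.
Proof. by move=> z []. Qed.

Lemma compact_matched c c' : compact (matched c c').
Proof.
apply: (@subclosed_compact _ _ (`[0, 1]%classic `*` `[0, 1]%classic : set (R * R))).
- exact: closed_matched.
- by apply: compact_setX; exact: segment_compact.
- exact: matched_square.
Qed.

End Matching.

(** * The radial homeomorphism carrying the link to its antipode *)

Section Amphichirality.
Variables (R : realType) (G : graph) (W : drawing R G) (dual : edge G -> edge G).
Hypothesis W_map : is_map W.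
Hypothesis W_self_dual : is_dual W (antipode W) dual.
Variables (C : finType) (s t : C -> edge G) (K : drawing R (Graph s t)).
Hypothesis K_medial : is_medial W (antipode W) dual K.
Hypothesis K_antipodal : (fun x : 'rV[R]_3 => - x) @` drawn K = drawn K.

Local Notation base := (arm_base s t).
Local Notation left := (on_left W (antipode W) dual K).
Local Notation right := (on_right W (antipode W) dual K).
Local Notation matched := (matched W dual K).

Variable rho : C -> R -> R.
Hypothesis continuous_rho : forall c, {within `[0, 1], continuous (rho c)}.
Hypothesis rho_gt0 : forall c x, 0 <= x <= 1 -> 0 < rho c x.

Lemma continuous_within_ln_rho c : {within `[0, 1], continuous (fun x => ln (rho c x))}.
Proof.
apply/subspace_continuousP => x x01.
have /subspace_continuousP/(_ x x01) cr := @continuous_rho c.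
by apply: (cvg_comp _ _ cr); apply: continuous_ln; apply: rho_gt0.
Qed.

(** The function is the constant term forced by the slope [expR (a p)] if the height at [z.1] is to
    go to that at [z.2]. *)
Lemma matched_ratio_continuous (a : 'rV[R]_3 -> R) c c' : continuous a ->
  {within matched c c', continuous (fun z : R * R =>
    ln (rho c' z.2) - expR (a (arc K c z.1)) * ln (rho c z.1))}.
Proof.
move=> ca; have Km := medial_map K_medial.
have cea : {within `[0, 1], continuous (fun x => expR (a (arc K c x)))}.
  apply/subspace_continuousP => x x01.
  have /subspace_continuousP/(_ x x01) ck := @map_continuous _ _ _ Km c.
  apply: (cvg_comp _ _ (cvg_comp _ _ ck (ca _))); exact: continuous_expR.
apply: (continuous_subspaceW (@matched_square _ _ _ _ _ _ _ _ c c')).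
exact: (continuous_sub (continuous_square2 (@continuous_within_ln_rho c'))
  (continuous_mul (continuous_square1 cea)
    (continuous_square1 (@continuous_within_ln_rho c)))).
Qed.

Variables hl hr : edge G -> R.
Hypothesis hlP : forall c (b : bool), left (c, b) -> rho c b%:R = hl (base (c, b)).
Hypothesis hrP : forall c (b : bool), right (c, b) -> rho c b%:R = hr (base (c, b)).

(* The slope of the affine map taking the logarithms of the heights of the two
   strands at [e] to those at the antipodal crossing. *)
Definition log_ratio e :=
  (ln (hl (dual e)) - ln (hr (dual e))) / (ln (hl e) - ln (hr e)).
Hypothesis log_ratio_gt0 : forall e, 0 < log_ratio e.

(** The slope [log_ratio] is that of the affine map matching both strands, so left and right heights
    give the same constant term. *)
Lemma matched_ratio_end (a : 'rV[R]_3 -> R) c c' x x' (b : bool) :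
  (forall e, a (pt K e) = ln (log_ratio e)) ->
  matched c c' (x, x') -> x = b%:R ->
  ln (rho c' x') - expR (a (arc K c x)) * ln (rho c x) =
  ln (hl (dual (base (c, b)))) - log_ratio (base (c, b)) * ln (hl (base (c, b))).
Proof.
move=> aE [/= x01 x'01 xx' ss] xb.
have [b' [x'b' baseb']] := matched_end W_self_dual K_medial x'01 xx' xb.
have := ss _ _ xb x'b'; rewrite xb x'b' (arc_end K_medial) aE lnK ?posrE //.
set e := base (c, b); have q0 := log_ratio_gt0 e.
case=> -[].
  by move=> /hlP -> /hlP ->; rewrite baseb'.
move=> /hrP -> /hrP ->; rewrite baseb' -/e.
(* Division by 0 yields 0, so a zero denominator would contradict [log_ratio_gt0]. *)
have d0 : ln (hl e) - ln (hr e) != 0.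
  by apply: contraTneq q0; rewrite /log_ratio => ->; rewrite invr0 mulr0 ltxx.
rewrite /log_ratio; field; exact: d0.
Qed.

(** The constant term depends only on the point of the medial map: by [matched_ratio_end] at a
    crossing, and elsewhere because the point and its antipode each have a single parameter. *)
Lemma matched_ratio_inj (a : 'rV[R]_3 -> R) c c' x x' d d' y y' :
  (forall e, a (pt K e) = ln (log_ratio e)) ->
  matched c c' (x, x') -> matched d d' (y, y') -> arc K c x = arc K d y ->
  ln (rho c' x') - expR (a (arc K c x)) * ln (rho c x) =
  ln (rho d' y') - expR (a (arc K d y)) * ln (rho d y).
Proof.
move=> aE m n xy; have Km := medial_map K_medial.
have [/= x01 x'01 xx' _] := m; have [/= y01 y'01 yy' _] := n.
have [[b xb]|nb] := pselect (exists b : bool, x = b%:R).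
  have [b' yb'] : exists b' : bool, y = b'%:R.
    apply: (@arc_pt _ _ _ _ _ _ _ _ K_medial d y (base (c, b))) => //.
    by rewrite -xy xb (arc_end K_medial).
  rewrite (matched_ratio_end aE m xb) (matched_ratio_end aE n yb').
  suff -> : base (c, b) = base (d, b') by [].
  by apply: (map_pt_inj Km); rewrite -!(arc_end K_medial) -xb -yb'.
have interior (z : R) : 0 <= z <= 1 -> ~ (exists b : bool, z = b%:R) -> 0 < z < 1.
  move=> /andP[z0 z1] nz; rewrite !lt_neqAle z0 z1 !andbT.
  by apply/andP; split; apply/eqP => zE; case: nz; [exists false|exists true].
have [cd xyE] := map_simple Km (interior _ x01 nb) y01 xy.
have nb' : ~ (exists b : bool, x' = b%:R).
  move=> [b x'b]; case: nb.
  have [_ /= _ x'x _] := matched_sym m.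
  have [b' [xb' _]] := matched_end W_self_dual K_medial x01 x'x x'b.
  by exists b'.
have x'y' : arc K c' x' = arc K d' y' by rewrite xx' yy' xy.
have [cd' xyE'] := map_simple Km (interior _ x'01 nb') y'01 x'y'.
by rewrite xy cd cd' xyE xyE'.
Qed.

Lemma radial_antipode : exists a B : 'rV[R]_3 -> R, exists M : R,
  [/\ continuous a, continuous B, forall x, `|a x| <= M, forall x, `|B x| <= M &
    forall c c' x x', matched c c' (x, x') ->
      radial a B (rho c x *: arc K c x) = rho c' x' *: arc K c x].
Proof.
have Km := medial_map K_medial.
have [a [Ma [ca aM aE]]] : exists a : 'rV[R]_3 -> R, exists M : R,
    [/\ continuous a, forall y, `|a y| <= M &
      forall e x, [set (0 : R)] x -> a (pt K e) = ln (log_ratio e)].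
  (* The slope is prescribed on the finite set of crossings; the parameter 0 is a dummy. *)
  apply: (@extension_along _ _ _ _ (fun e => [set (0 : R)]) (fun e _ => pt K e)
    (fun e _ => ln (log_ratio e))).
  - by move=> e; exact: compact_set1.
  - by move=> e; apply: continuous_subspaceT; exact: cst_continuous.
  - by move=> e; apply: continuous_subspaceT; exact: cst_continuous.
  - by move=> e e' x y _ _ /(map_pt_inj Km) ->.
have {}aE e : a (pt K e) = ln (log_ratio e) by exact: (aE e 0).
have [B [MB [cB BM BE]]] : exists B : 'rV[R]_3 -> R, exists M : R,
    [/\ continuous B, forall y, `|B y| <= M &
      forall (cc : C * C) z, matched cc.1 cc.2 z -> B (arc K cc.1 z.1) =
        ln (rho cc.2 z.2) - expR (a (arc K cc.1 z.1)) * ln (rho cc.1 z.1)].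
  apply: (@extension_along _ _ _ _ (fun cc : C * C => matched cc.1 cc.2)
    (fun cc z => arc K cc.1 z.1)
    (fun cc z => ln (rho cc.2 z.2) - expR (a (arc K cc.1 z.1)) * ln (rho cc.1 z.1))).
  - by move=> cc; exact: compact_matched.
  - move=> cc; apply: (continuous_subspaceW (@matched_square _ _ _ _ _ _ _ _ _ _)).
    exact: (continuous_square1 (@map_continuous _ _ _ Km cc.1)).
  - by move=> cc; exact: matched_ratio_continuous.
  - by move=> cc dd [x x'] [y y']; exact: matched_ratio_inj.
exists a, B, (Num.max Ma MB); split=> //.
- by move=> x; rewrite le_max aM.
- by move=> x; rewrite le_max BM orbT.
move=> c c' x x' m; have [/= x01 x'01 _ _] := m.
have sx : sphere (arc K c x).
  by apply: (map_sphere Km); right; exists c => //; exists x.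
have := BE (c, c') (x, x') m => /= Bx.
by rewrite radial_ray ?rho_gt0 // Bx addrC subrK lnK // posrE rho_gt0.
Qed.
End Amphichirality.

(** The signs enter through the slopes: being equal at antipodal crossings, they make [log_ratio]
    positive, as [radial_antipode] requires. *)
Lemma represents_amphichiral (R : realType) (G : graph) (W : drawing R G)
    (dual : edge G -> edge G) (W_map : is_map W)
    (W_self_dual : is_dual W (antipode W) dual)
    (C : finType) (s t : C -> edge G) (K : drawing R (Graph s t))
    (K_medial : is_medial W (antipode W) dual K)
    (K_antipodal : (fun x : 'rV[R]_3 => - x) @` drawn K = drawn K)
    (S : edge G -> bool)
    (S_antipodal : forall e e', pt K e' = - pt K e -> S e = S e')
    (L : set 'rV[R]_3) (L_link : represents W (antipode W) dual K S L) :
  amphichiral L.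
Proof.
have [rho [/= rho_cont rho_gt0 LE same over]] := L_link.
(* One arm of each strand is chosen at every crossing; by [same], the height of the strand does not
   depend on the choice. *)
have [la laP] := choice (exists_left K_medial).
have [ra raP] := choice (exists_right K_medial).
pose height (a : C * bool) := rho a.1 (arm_param a 0).
pose hl e := height (la e); pose hr e := height (ra e).
have heightE c b : height (c, b) = rho c b%:R.
  by rewrite /height /arm_param /=; case: b; rewrite ?subr0.
have hlP c (b : bool) : on_left W (antipode W) dual K (c, b) ->
    rho c b%:R = hl (arm_base s t (c, b)).
  move=> l; rewrite -heightE; have [lE ll] := laP (arm_base s t (c, b)).
  by apply: same; [rewrite lE|left].
have hrP c (b : bool) : on_right W (antipode W) dual K (c, b) ->
    rho c b%:R = hr (arm_base s t (c, b)).
  move=> r; rewrite -heightE; have [rE rr] := raP (arm_base s t (c, b)).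
  by apply: same; [rewrite rE|right].
have h_gt0 a : 0 < height a.
  by case: a => c b; rewrite heightE rho_gt0 //; case: b; rewrite lexx ler01.
have hlr e : if S e then ln (hr e) < ln (hl e) else ln (hl e) < ln (hr e).
  have [lE ll] := laP e; have [rE rr] := raP e.
  have := over (la e) (ra e); rewrite lE rE => /(_ erefl ll rr).
  by case: (S e); rewrite ltr_ln ?posrE ?h_gt0.
have q_gt0 e : 0 < log_ratio dual hl hr e.
  have Se : S (dual e) = S e.
    by rewrite (S_antipodal e (dual e)) // (pt_dual W_self_dual K_medial).
  have := hlr e; have := hlr (dual e); rewrite Se /log_ratio; case: (S e) => h1 h2.
    by rewrite divr_gt0 // subr_gt0.
  (* For the sign - both differences of logarithms are negative. *)
  by rewrite -mulrNN -invrN !opprB divr_gt0 // subr_gt0.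
have [a [B [M [ca cB aM BM gE]]]] :=
  radial_antipode W_map W_self_dual K_medial rho_cont rho_gt0 hlP hrP q_gt0.
apply: (amphichiral_radial ca cB aM BM).
have total := matched_total W_self_dual K_medial K_antipodal.
apply/seteqP; split => y.
  move=> [z + <-]; rewrite {1}LE => -[c _ [x x01 <-]].
  have [c' [x' m]] := total c x x01; rewrite (gE _ _ _ _ m).
  have [_ /= x'01 xx' _] := m; exists (rho c' x' *: arc K c' x').
    by rewrite LE; exists c' => //; exists x'.
  by rewrite xx' scalerN opprK.
move=> [z + <-]; rewrite {1}LE => -[c _ [x x01 <-]].
(* The preimage of [- z] is the point of the link over the antipode of the point below [z], on the
   matched strand. *)
have [c' [x' /matched_sym m]] := total c x x01.
have [/= x'01 _ xx' _] := m; exists (rho c' x' *: arc K c' x').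
  by rewrite LE; exists c' => //; exists x'.
by rewrite (gE _ _ _ _ m) xx' scalerN opprK.
Qed.

Theorem corollary3 (R : realType) (n : nat) (n_odd : odd n)
    (W : drawing R (wheel n)) (W_map : is_map W)
    (dual : edge (wheel n) -> edge (wheel n))
    (W_self_dual : is_dual W (antipode W) dual)
    (C : finType) (s t : C -> edge (wheel n)) (K : drawing R (Graph s t))
    (K_medial : is_medial W (antipode W) dual K)
    (K_antipodal : (fun x : 'rV[R]_3 => - x) @` drawn K = drawn K)
    (S : edge (wheel n) -> bool)
    (S_antipodal : forall e e', pt K e' = - pt K e -> S e = S e')
    (L : set 'rV[R]_3)
    (L_link : represents W (antipode W) dual K S L) :
  amphichiral L.
Proof.
exact: (represents_amphichiral W_map W_self_dual K_medial K_antipodal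
  S_antipodal L_link).
Qed.
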